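(* Let $\mathbb{F}$ be a division ring, $\sigma$ an automorphism of $\mathbb{F}$, $\delta$ a $\sigma$-derivation of $\mathbb{F}$, and $\mathcal{R}=\mathbb{F}[x;\sigma,\delta]$. Let $f,g\in\mathcal{R}$ be two skew polynomials of positive degree $m$ and $n$, respectively. Then the following conditions are equivalent: 1) $R^{\sigma,\delta}_{\mathbb{F},L}(f,g)=0$; 2) $f$ and $g$ have a common (non-unit) left factor in $\mathcal{R}$; 3) $\mathrm{gcld}(f,g)\neq1$, where gcld means greatest common left divisor; 4) there are no polynomials $p,q\in\mathcal{R}$ such that $fp+gq=1$; 5) $f\mathcal{R}+g\mathcal{R}\subsetneq\mathcal{R}$.
   Context: A $\sigma$-derivation is an additive map $\delta:\mathbb{F}\to\mathbb{F}$ with $\delta(ab)=\sigma(a)\delta(b)+\delta(a)b$. The skew polynomial ring $\mathcal{R}=\mathbb{F}[x;\sigma,\delta]$ is the set of polynomials $\sum_i a_ix^i$ ($a_i\in\mathbb{F}$) with usual addition and multiplication determined by $xa=\sigma(a)x+\delta(a)$. Since $\sigma$ is an automorphism, left division with remainder holds, every right ideal is principal, and every element of $\mathcal{R}$ can be written uniquely with right-hand coefficients, $\sum_i x^i\mathcal{A}_i$. For $a\in\mathbb{F}$ and integers $t,r\ge0$, $\mathcal{T}_{t,r}(a)$ is the sum of all possible compositions of $t$ copies of $\delta\sigma^{-1}$ and $r$ copies of $\sigma^{-1}$ evaluated at $a$, with $\mathcal{T}_{0,0}(a)=a$. Left $(\sigma,\delta)$-resultant: let $f=\sum_{i=0}^m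 x^iA_i$ and $g=\sum_{i=0}^n x^iB_i$ have degrees $m,n\ge0$, and put $A_s=0$ for $s\notin\{0,\dots,m\}$, $B_s=0$ for $s\notin\{0,\dots,n\}$. The left $(\sigma,\delta)$-Sylvester matrix $M=\mathrm{Sylv}^{\sigma,\delta}_{\mathbb{F},L}(f,g)$ is the $(m+n)\times(m+n)$ matrix whose first $n$ rows involve the $A_i$'s and whose last $m$ rows involve the $B_i$'s, as follows (columns indexed by $t=0,\dots,m+n-1$): for $j=0,\dots,n-1$, the $(j+1)$-th row has $t$-th entry $\sum_{i=0}^{j}(-1)^{j+i}\mathcal{T}_{j-i,i}(A_{t-i})$; for $j=0,\dots,m-1$, the $(n+j+1)$-th row has $t$-th entry $\sum_{i=0}^{j}(-1)^{j+i}\mathcal{T}_{j-i,i}(B_{t-i})$. (Thus the rows are, in order, the vectors of right-hand coefficients with respect to $1,x,\dots,x^{m+n-1}$ of $f,fx,\dots,fx^{n-1},g,gx,\dots,gx^{m-1}$.) The left resultant $R^{\sigma,\delta}_{\mathbb{F},L}(f,g)$ is the Dieudonné determinant of $M$, which takes values in $\{0\}\cup\mathbb{F}^*/[\mathbb{F}^*,\mathbb{F}^*]$, where $\mathbb{F}^*=\mathbb{F}\setminus\{0\}$.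
   Formalization: The Dieudonné determinant is taken with rows as vectors of the right F-space (in effect that of the transpose); with the usual left-row convention 1) and 2) disagree, e.g. over the quaternions for f=x+i, g=(x+i)j with σ=id, δ=0. *)

(* Defs.v *)
From HB Require Import structures.
From mathcomp Require Import all_boot all_order all_algebra generic_quotient.
From mathcomp Require Import boolp classical_sets.

Set Implicit Arguments.
Unset Strict Implicit.
Unset Printing Implicit Defensive.

Import GRing.Theory.
Local Open Scope ring_scope.
Local Open Scope quotient_scope.

Definition sigma_derivation (F : nzRingType) (sigma delta : F -> F) : Prop :=
  forall a b : F, delta (a * b) = sigma a * delta b + delta a * b.

(** The skew polynomial ring F[x; sigma, delta].  The carrier is {poly F}, the
    i-th entry of the list being the left-hand coefficient of x^i; only the
    product differs from the one of {poly F}. *)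
Definition skewpoly (F : nzRingType) (sigma : {rmorphism F -> F})
  (delta : {additive F -> F}) (deltaM : sigma_derivation sigma delta) : Type :=
  {poly F}.

Section SkewPolyRing.
Variables (F : nzRingType) (sigma : {rmorphism F -> F}).
Variables (delta : {additive F -> F}) (deltaM : sigma_derivation sigma delta).

Implicit Types (p q r : {poly F}) (a : F).

(** x * (sum_i a_i x^i) = sum_i (sigma(a_i) x^(i+1) + delta(a_i) x^i) *)
Definition skew_mulX p : {poly F} := map_poly sigma p * 'X + map_poly delta p.

Definition skew_mul p q : {poly F} :=
  \sum_(i < size p) p`_i *: iter i skew_mulX q.

Let skew_mulX_is_zmod : zmod_morphism skew_mulX.
Proof. by move=> p q; rewrite /skew_mulX !raddfB mulrBl addrACA opprD. Qed.
HB.instance Definition _ :=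
  GRing.isZmodMorphism.Build {poly F} {poly F} skew_mulX skew_mulX_is_zmod.

Let iterD i : {morph iter i skew_mulX : p q / p + q}.
Proof. by elim: i => [|i IH] p q //=; rewrite IH raddfD. Qed.

Let skew_mulXZ a p : skew_mulX (a *: p) = sigma a *: skew_mulX p + delta a *: p.
Proof.
apply/polyP=> i; rewrite /skew_mulX !(coefD, coefZ, coefMX, coef_map_id0) ?raddf0 //.
rewrite deltaM; case: i => [|i] /=; rewrite ?mulr0 ?add0r // ?rmorphM ?mulrDr ?addrA //.
Qed.

Let skew_mulEw n p q : (size p <= n)%N ->
  skew_mul p q = \sum_(i < n) p`_i *: iter i skew_mulX q.
Proof.
move=> le_pn; rewrite /skew_mul (big_ord_widen n (fun i => p`_i *: iter i skew_mulX q)) //.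
rewrite [RHS](bigID (fun i : 'I_n => (i < size p)%N)) /= [X in _ + X]big1 ?addr0 //.
by move=> i; rewrite -leqNgt => /leq_sizeP/(_ _ (leqnn _))->; rewrite scale0r.
Qed.

Let skew_mulDl : left_distributive skew_mul +%R.
Proof.
move=> p q r; set n := maxn (size p) (size q).
rewrite (@skew_mulEw n) ?size_polyD // (@skew_mulEw n p) ?leq_maxl //.
rewrite (@skew_mulEw n q) ?leq_maxr // -big_split.
by apply: eq_bigr => i _; rewrite coefD scalerDl.
Qed.

Let skew_mulDr : right_distributive skew_mul +%R.
Proof.
move=> p q r; rewrite /skew_mul -big_split.
by apply: eq_bigr => i _; rewrite iterD scalerDr.
Qed.

Let skew_mul0l q : skew_mul 0 q = 0.
Proof. by rewrite /skew_mul size_poly0 big_ord0. Qed.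

Let skew_mulZl a p q : skew_mul (a *: p) q = a *: skew_mul p q.
Proof.
rewrite (@skew_mulEw (size p)) ?size_scale_leq // /skew_mul scaler_sumr.
by apply: eq_bigr => i _; rewrite coefZ scalerA.
Qed.

Let skew_mulMl i q : skew_mul 'X^i q = iter i skew_mulX q.
Proof.
rewrite (@skew_mulEw i.+1) ?size_polyXn // big_ord_recr /= coefXn eqxx scale1r.
rewrite big1 ?add0r // => j _; rewrite coefXn.
by rewrite ltn_eqF ?scale0r.
Qed.

Let skew_mulX_Xn i : skew_mulX 'X^i = 'X^(i.+1).
Proof.
apply/polyP=> j; rewrite /skew_mulX coefD coefMX !coef_map_id0 ?raddf0 //.
have d1 : delta 1 = 0.
  by apply: (addrI (delta 1)); rewrite addr0 -{3}[1]mulr1 deltaM rmorph1 mul1r mulr1.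
rewrite !coefXn; have -> : delta (j == i)%:R = 0 by case: eqP; rewrite ?raddf0.
by rewrite addr0; case: j => [|j] //=; rewrite rmorph_nat eqSS.
Qed.

Let skew_mulX_mul p q : skew_mul (skew_mulX p) q = skew_mulX (skew_mul p q).
Proof.
have suml (I : Type) (s : seq I) (G : I -> {poly F}) :
    skew_mul (\sum_(i <- s) G i) q = \sum_(i <- s) skew_mul (G i) q.
  by apply: (big_morph (skew_mul^~ q)) => [u v|]; rewrite ?skew_mulDl ?skew_mul0l.
rewrite -{1}[p]coefK poly_def raddf_sum suml [in RHS]/skew_mul raddf_sum.
apply: eq_bigr => i _ /=; rewrite !skew_mulXZ skew_mulDl !skew_mulZl.
by rewrite skew_mulX_Xn !skew_mulMl.
Qed.

Let skew_mulA : associative skew_mul.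
Proof.
move=> p q r; rewrite [in LHS]/skew_mul [in RHS]/(skew_mul p q).
rewrite (big_morph (skew_mul^~ r) (id1 := 0) (op1 := +%R)); first last.
- by rewrite skew_mul0l.
- by move=> u v; rewrite skew_mulDl.
apply: eq_bigr => i _; rewrite skew_mulZl; congr (_ *: _).
by elim: (i : nat) => //= k ->; rewrite skew_mulX_mul.
Qed.

Let skew_mul1l : left_id 1 skew_mul.
Proof. by move=> p; rewrite -(expr0 'X) skew_mulMl. Qed.

Let skew_mul1r : right_id 1 skew_mul.
Proof.
move=> p; rewrite /skew_mul -[RHS]coefK poly_def; apply: eq_bigr => i _.
congr (_ *: _); elim: (i : nat) => [|k IH]; first by rewrite expr0.
by rewrite iterS IH skew_mulX_Xn.
Qed.

Let skew_one_neq0 : (1 : {poly F}) != 0. Proof. exact: oner_neq0. Qed.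

HB.instance Definition _ := GRing.Zmodule.copy (skewpoly deltaM) {poly F}.
HB.instance Definition _ := GRing.Zmodule_isNzRing.Build (skewpoly deltaM)
  skew_mulA skew_mul1l skew_mul1r skew_mulDl skew_mulDr skew_one_neq0.

Definition skewC a : skewpoly deltaM := a%:P.
Definition skewX : skewpoly deltaM := 'X.

Definition skew_deg (f : skewpoly deltaM) : nat := (size (f : {poly F})).-1.
Definition skew_monic (f : skewpoly deltaM) : Prop :=
  lead_coef (f : {poly F}) = 1.

Lemma skewCM a (f : skewpoly deltaM) : skewC a * f = a *: (f : {poly F}).
Proof.
have -> : skewC a = a *: 1 :> {poly F} by rewrite /skewC -mul_polyC mulr1.
by rewrite [LHS]skew_mulZl skew_mul1l.
Qed.

Lemma skewXM (f : skewpoly deltaM) : skewX * f = skew_mulX f.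
Proof. exact: (skew_mulMl 1). Qed.

Lemma skewXnE n : skewX ^+ n = 'X^n :> {poly F}.
Proof. by elim: n => [|n IH]; [rewrite !expr0 | rewrite exprS skewXM IH skew_mulX_Xn]. Qed.

Lemma skewXC a : skewX * skewC a = skewC (sigma a) * skewX + skewC (delta a).
Proof. by rewrite skewXM skewCM /skew_mulX /skewC !map_polyC /= mul_polyC. Qed.

Lemma skewpolyE (f : skewpoly deltaM) :
  f = \sum_(i < size (f : {poly F})) skewC (f : {poly F})`_i * skewX ^+ i.
Proof.
rewrite -[LHS]coefK poly_def; apply: eq_bigr => i _.
by rewrite skewCM skewXnE.
Qed.

End SkewPolyRing.

Section RightCoefficients.
Variables (F : nzRingType) (sigma : {rmorphism F -> F}) (sigmaV : F -> F).
Variables (delta : {additive F -> F}) (deltaM : sigma_derivation sigma delta).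

(** If p lists the right-hand coefficients of f, then rcoef_mulX p lists those
    of f * x, because A x = x sigma^-1(A) - delta(sigma^-1(A)). *)
Definition rcoef_mulX (p : {poly F}) : {poly F} :=
  \poly_(i < size p) sigmaV p`_i * 'X - \poly_(i < size p) delta (sigmaV p`_i).

(** The sequence (A_i)_i such that f = sum_i x^i A_i. *)
Definition rcoefs (f : skewpoly deltaM) : {poly F} :=
  \sum_(j < size (f : {poly F})) iter j rcoef_mulX ((f : {poly F})`_j)%:P.

Hypothesis sigmaVK : cancel sigmaV sigma.

Let ev (p : {poly F}) : skewpoly deltaM :=
  \sum_(i < size p) skewX deltaM ^+ i * skewC deltaM p`_i.

Let skewCB a b : skewC deltaM (a - b) = skewC deltaM a - skewC deltaM b.
Proof. exact: polyCB. Qed.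

Let skewC0 : skewC deltaM 0 = 0. Proof. exact: polyC0. Qed.

Let evEw n (p : {poly F}) : (size p <= n)%N ->
  ev p = \sum_(i < n) skewX deltaM ^+ i * skewC deltaM p`_i.
Proof.
move=> le_pn; rewrite /ev.
rewrite (big_ord_widen n (fun i => skewX deltaM ^+ i * skewC deltaM p`_i)) //.
rewrite [RHS](bigID (fun i : 'I_n => (i < size p)%N)) /= [X in _ + X]big1 ?addr0 //.
by move=> i; rewrite -leqNgt => /leq_sizeP/(_ _ (leqnn _))->; rewrite skewC0 mulr0.
Qed.

Let evB : zmod_morphism ev.
Proof.
move=> p q; set n := maxn (size p) (size q).
rewrite (@evEw n (p - q)); last by rewrite (leq_trans (size_polyD _ _)) ?size_polyN.
rewrite (@evEw n p) ?leq_maxl // (@evEw n q) ?leq_maxr // -sumrB.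
by apply: eq_bigr => i _; rewrite coefB skewCB mulrBr.
Qed.
HB.instance Definition _ :=
  GRing.isZmodMorphism.Build {poly F} (skewpoly deltaM) ev evB.

Let evX p : ev (rcoef_mulX p) = ev p * skewX deltaM.
Proof.
rewrite /rcoef_mulX raddfB /=.
set q := (X in X * 'X); set r := (X in _ - ev X).
have sq : (size q <= size p)%N by exact: size_poly.
have sr : (size r <= size p)%N by exact: size_poly.
rewrite (@evEw (size p).+1); last first.
  by rewrite (leq_trans (size_polyMleq _ _)) // size_polyX addn2.
rewrite big_ord_recl coefMX /= skewC0 mulr0 add0r (evEw sr) -sumrB.
rewrite [in RHS]/ev mulr_suml; apply: eq_bigr => i _.
rewrite coefMX /= !coef_poly ltn_ord exprSr -!mulrA -mulrBr.
by rewrite skewXC sigmaVK addrK.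
Qed.

Lemma rcoefsE (f : skewpoly deltaM) : f =
  \sum_(i < size (rcoefs f)) skewX deltaM ^+ i * skewC deltaM (rcoefs f)`_i.
Proof.
rewrite -/(ev (rcoefs f)) /rcoefs raddf_sum /= [LHS]skewpolyE.
apply: eq_bigr => j _; elim: (j : nat) (_`_j) => [|k IH] a /=.
  rewrite expr0 mulr1 (@evEw 1) ?size_polyC_leq1 // big_ord1.
  by rewrite expr0 mul1r coefC.
by rewrite evX -IH exprSr mulrA.
Qed.

End RightCoefficients.

Inductive commutator_subgroup (F : unitRingType) : F -> Prop :=
| comm_commutator a b : a \is a GRing.unit -> b \is a GRing.unit ->
    commutator_subgroup (a * b * a^-1 * b^-1)
| comm_mul c d : commutator_subgroup c -> commutator_subgroup d ->
    commutator_subgroup (c * d)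
| comm_inv c : commutator_subgroup c -> commutator_subgroup c^-1.

Lemma commutator_subgroup1 (F : unitRingType) : @commutator_subgroup F 1.
Proof.
by have := comm_commutator (unitr1 F) (unitr1 F); rewrite !divr1 mulr1.
Qed.

Lemma commutator_subgroup_unit (F : unitRingType) (c : F) :
  commutator_subgroup c -> c \is a GRing.unit.
Proof.
elim=> {c} [a b ua ub|c d _ uc _ ud|c _ uc]; last by rewrite unitrV.
- by do ?[apply: rpredM]; rewrite ?unitrV.
- exact: rpredM.
Qed.

(** {0} \cup F^*/[F^*,F^*] is the set of cosets a [F^*,F^*] for a in F. *)
Definition dieudonne_rel (F : unitRingType) : rel F := fun a b =>
  `[< exists2 c, commutator_subgroup c & a = b * c >].

Section DieudonneValues.
Variable F : unitRingType.

Let dieudonne_rel_refl : reflexive (@dieudonne_rel F).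
Proof.
by move=> a; apply/asboolP; exists 1; rewrite ?mulr1 //; apply: commutator_subgroup1.
Qed.

Let dieudonne_rel_sym : symmetric (@dieudonne_rel F).
Proof.
have H a b : dieudonne_rel a b -> dieudonne_rel b a.
  move=> /asboolP[c hc ->]; apply/asboolP; exists c^-1; first exact: comm_inv.
  by rewrite mulrK // commutator_subgroup_unit.
by move=> a b; apply/idP/idP; apply: H.
Qed.

Let dieudonne_rel_trans : transitive (@dieudonne_rel F).
Proof.
move=> b a d /asboolP[c hc ->] /asboolP[c' hc' ->]; apply/asboolP.
by exists (c' * c); [apply: comm_mul | rewrite mulrA].
Qed.

Canonical dieudonne_equiv := EquivRel (@dieudonne_rel F)
  dieudonne_rel_refl dieudonne_rel_sym dieudonne_rel_trans.

End DieudonneValues.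

Definition dieudonne_value (F : unitRingType) := {eq_quot @dieudonne_equiv F}.

Definition dieudonne_class (F : unitRingType) (a : F) : dieudonne_value F :=
  \pi_(dieudonne_value F) a.

Lemma dieudonne_class_eq0 (F : unitRingType) (a : F) :
  dieudonne_class a = dieudonne_class 0 <-> a = 0.
Proof.
split=> [/eqmodP/asboolP[c _ ->]|->//]; exact: mul0r.
Qed.

(** Gaussian elimination, the rows being vectors of the RIGHT vector space F^n
    (they will hold right-hand coefficients): a pivot a in the first column, in
    row i, is moved to the top, which contributes the sign (-1)^i, and then
    row_i * (a^-1 b) is subtracted from each row that starts with b.  The class
    modulo commutators does not depend on the pivots.  Over a noncommutative F,
    the convention where rows are vectors of the left vector space gives the
    determinant of the transpose instead. *)
Fixpoint dieudonne_elim (F : unitRingType) (n : nat) : 'M[F]_n -> F :=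
  match n with
  | 0 => fun _ => 1
  | n'.+1 => fun M =>
      if [pick i | M i 0 != 0] is Some i then
        (-1) ^+ i * M i 0 * dieudonne_elim (\matrix_(k < n', l < n')
          (M (lift i k) (lift 0 l)
           - M i (lift 0 l) * ((M i 0)^-1 * M (lift i k) 0)))
      else 0
  end.

Definition dieudonne_det (F : unitRingType) (n : nat) (M : 'M[F]_n) :
  dieudonne_value F := dieudonne_class (dieudonne_elim M).

(** Sum over all words with t letters delta \o sigma^-1 (true) and r letters
    sigma^-1 (false) of the corresponding composition, evaluated at a. *)
Definition skewT (F : nzRingType) (sigmaV delta : F -> F) (t r : nat) (a : F) : F :=
  \sum_(w : (t + r).-tuple bool | count_mem true w == t)
    foldr (fun (b : bool) y => if b then delta (sigmaV y) else sigmaV y) a w.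

Section Resultant.
Variables (F : unitRingType) (sigma : {rmorphism F -> F}) (sigmaV : F -> F).
Variables (delta : {additive F -> F}) (deltaM : sigma_derivation sigma delta).

(** A_(t-i) is 0 for t < i, and A`_s is 0 for s beyond the degree. *)
Definition sylvester_entry (A : {poly F}) (j t : nat) : F :=
  \sum_(i < j.+1) (-1) ^+ (j + i) *
    skewT sigmaV delta (j - i) i (if (i <= t)%N then A`_(t - i) else 0).

Definition left_sylvester (f g : skewpoly deltaM) :
    'M[F]_(skew_deg f + skew_deg g) :=
  \matrix_(k, t)
    if (k < skew_deg g)%N then sylvester_entry (rcoefs sigmaV f) k t
    else sylvester_entry (rcoefs sigmaV g) (k - skew_deg g) t.

Definition left_resultant (f g : skewpoly deltaM) : dieudonne_value F :=
  dieudonne_det (left_sylvester f g).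

End Resultant.

Definition two_sided_unit (R : nzRingType) (u : R) : Prop :=
  exists v : R, u * v = 1 /\ v * u = 1.

Definition left_divides (R : nzRingType) (d f : R) : Prop :=
  exists q : R, f = d * q.

Section Gcld.
Variables (F : nzRingType) (sigma : {rmorphism F -> F}).
Variables (delta : {additive F -> F}) (deltaM : sigma_derivation sigma delta).

(** A greatest common left divisor is only determined up to right
    multiplication by a unit; being monic makes it unique. *)
Definition is_gcld (f g d : skewpoly deltaM) : Prop :=
  [/\ skew_monic d, left_divides d f, left_divides d g &
      forall e : skewpoly deltaM,
        left_divides e f -> left_divides e g -> left_divides e d].

(** Defaults to 0, the gcld of 0 and 0, which have no monic one. *)
Definition gcld (f g : skewpoly deltaM) : skewpoly deltaM :=
  xget 0 [set d | is_gcld f g d]%classic.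

End Gcld.

Definition sum_right_ideals (R : nzRingType) (f g : R) : set R :=
  [set h | exists p q : R, h = f * p + g * q]%classic.

(* Main.v *)
(** Gaussian elimination shows that the resultant vanishes iff the rows of the
    Sylvester matrix are right linearly dependent, and that otherwise they span.
    Row by row these are the right-hand coefficients of f x^k and g x^k, so a
    nonzero resultant yields f p + g q = 1, while a zero one yields a relation
    f p + g q = 0 with p <> 0 and deg p < deg g.  Euclid's algorithm carried out
    on such a relation ends at a nonconstant common left factor of f and g.  The
    remaining implications only use that the ring has no zero divisors. *)

Require Import Defs.
From HB Require Import structures.
From mathcomp Require Import all_boot all_order all_algebra generic_quotient.
From mathcomp Require Import boolp classical_sets.

Set Implicit Arguments.
Unset Strict Implicit.
Unset Printing Implicit Defensive.

Import GRing.Theory.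
Local Open Scope ring_scope.

(** Splitting words by their first letter, which [foldr] applies last, yields the recursion for the
    operators $\mathcal{T}_{t,r}$. *)
Lemma sum_tuple_bool_cons (V : nmodType) n (P : pred (seq bool)) (G : seq bool -> V) :
  \sum_(w : n.+1.-tuple bool | P w) G w =
  \sum_(w : n.-tuple bool | P (true :: w)) G (true :: w) +
  \sum_(w : n.-tuple bool | P (false :: w)) G (false :: w).
Proof.
rewrite (reindex (fun u : bool * n.-tuple bool => [tuple of u.1 :: u.2])) /=; last first.
  exists (fun w : n.+1.-tuple bool => (thead w, [tuple of behead w])) => [[b w]|w] _ /=.
    by congr pair; apply: val_inj.
  by rewrite [RHS]tuple_eta; apply: val_inj.
rewrite -(pair_big_dep predT (fun b (w : n.-tuple bool) => P (b :: w))
  (fun b (w : n.-tuple bool) => G (b :: w))) /=.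
by rewrite big_bool.
Qed.

(** * Gaussian elimination over a division ring *)

Section DivisionRing.
Variables (F : unitRingType) (F_division : GRing.field_axiom F).

Lemma division_mulVr (x : F) : x != 0 -> x^-1 * x = 1.
Proof. by move=> /F_division; apply: mulVr. Qed.

Lemma division_mulrV (x : F) : x != 0 -> x * x^-1 = 1.
Proof. by move=> /F_division; apply: mulrV. Qed.

Lemma division_mulf_neq0 (x y : F) : x != 0 -> y != 0 -> x * y != 0.
Proof.
move=> x0 y0; apply: contra_neq y0 => xy0.
by rewrite -[y]mul1r -(division_mulVr x0) -mulrA xy0 mulr0.
Qed.

(** The matrix passed to the recursive call of [dieudonne_elim], allowed to be rectangular so that
    [tall_right_dependent] can use the same step. *)
Definition pivot_step m n (M : 'M[F]_(m.+1, n.+1)) (i : 'I_m.+1) : 'M[F]_(m, n) :=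
  \matrix_(k, l) (M (lift i k) (lift 0 l)
           - M i (lift 0 l) * ((M i 0)^-1 * M (lift i k) 0)).

Lemma dieudonne_elimS n (M : 'M[F]_n.+1) : dieudonne_elim M =
  if [pick i | M i 0 != 0] is Some i
  then (-1) ^+ i * M i 0 * dieudonne_elim (pivot_step M i) else 0.
Proof. by []. Qed.

Definition row_combination m n (M : 'M[F]_(m, n)) (c : 'I_m -> F) (l : 'I_n) : F :=
  \sum_k M k l * c k.

Definition right_dependent m n (M : 'M[F]_(m, n)) : Prop :=
  exists2 c : 'I_m -> F, (exists k, c k != 0) & forall l, row_combination M c l = 0.

(** Each row of [pivot_step M i] is a row of [M] minus a right multiple of the pivot row, so the
    coefficient of the pivot row stays free and can be chosen to give column 0 any value [b]. With
    [b = 0] dependences lift; with general [b] solutions of linear systems do. *)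
Lemma pivot_lift m n (M : 'M[F]_(m.+1, n.+1)) (i : 'I_m.+1) (c : 'I_m -> F) (b : F) :
  M i 0 != 0 ->
  exists c' : 'I_m.+1 -> F,
    [/\ forall k, c' (lift i k) = c k, row_combination M c' 0 = b &
     forall l, row_combination M c' (lift 0 l) =
       row_combination (pivot_step M i) c l + M i (lift 0 l) * ((M i 0)^-1 * b)].
Proof.
move=> Mi0; pose s := \sum_k M (lift i k) 0 * c k.
pose c' k := if unlift i k is Some k' then c k' else (M i 0)^-1 * (b - s).
have c'l k : c' (lift i k) = c k by rewrite /c' liftK.
have c'i : c' i = (M i 0)^-1 * (b - s) by rewrite /c' unlift_none.
have comb l : row_combination M c' l
    = M i l * ((M i 0)^-1 * (b - s)) + \sum_k M (lift i k) l * c k.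
  rewrite /row_combination (bigD1_ord i) //= c'i; congr (_ + _).
  by apply: eq_bigr => k _; rewrite c'l.
exists c'; split=> // [|l].
  by rewrite comb mulrA division_mulrV // mul1r subrK.
rewrite comb mulrBr mulrBr -addrA addrC; congr (_ + _).
rewrite addrC /row_combination; under [RHS]eq_bigr do rewrite mxE mulrBl.
rewrite sumrB; congr (_ - _); rewrite /s !mulr_sumr.
by apply: eq_bigr => k _; rewrite !mulrA.
Qed.

Lemma pivot_right_dependent m n (M : 'M[F]_(m.+1, n.+1)) (i : 'I_m.+1) :
  M i 0 != 0 -> right_dependent (pivot_step M i) -> right_dependent M.
Proof.
move=> Mi0 [c [k ck] cN]; have [c' [c'l c'0 c'S]] := pivot_lift c 0 Mi0.
exists c'; first by exists (lift i k); rewrite c'l.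
by move=> l; case: (unliftP 0 l) => [l'|] ->; rewrite // c'S cN !mulr0 addr0.
Qed.

Lemma col0_right_dependent m n (M : 'M[F]_(m, n.+1)) :
  (forall i, M i 0 = 0) -> right_dependent (col' 0 M) -> right_dependent M.
Proof.
move=> M0 [c c0 cN]; exists c => // l; case: (unliftP 0 l) => [l'|] ->.
  by rewrite -[RHS](cN l'); apply: eq_bigr => k _; rewrite mxE.
by apply: big1 => k _; rewrite M0 mul0r.
Qed.

(** Induction on the columns: a pivot removes one row and one column, while a zero first column is
    dropped, which leaves the matrix even taller. *)
Lemma tall_right_dependent m n (M : 'M[F]_(m, n)) : (n < m)%N -> right_dependent M.
Proof.
elim: n m M => [|n IH] [|m] M // ltnm.
  by exists (fun=> 1) => [|[]//]; exists 0; apply: oner_neq0.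
have [i Mi0|M0] := pickP (fun i => M i 0 != 0).
  by apply: (pivot_right_dependent Mi0); apply: IH.
apply: col0_right_dependent => [i|]; last by apply: IH; apply: ltnW.
by apply/eqP; have /negbT := M0 i; rewrite negbK.
Qed.

Lemma dieudonne_elim_eq0 n (M : 'M[F]_n) : dieudonne_elim M = 0 -> right_dependent M.
Proof.
elim: n M => [|n IH] M; first by move=> /eqP; rewrite oner_eq0.
rewrite dieudonne_elimS; case: pickP => [i Mi0|M0] E.
  apply: (pivot_right_dependent Mi0); apply: IH; apply/eqP.
  apply: contra_eqT E => E; rewrite division_mulf_neq0 // division_mulf_neq0 //.
  by rewrite signr_eq0.
(* Without a pivot, deleting the zero column leaves more rows than columns. *)
apply: col0_right_dependent => [i|]; last by apply: tall_right_dependent.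
by apply/eqP; have /negbT := M0 i; rewrite negbK.
Qed.

Lemma dieudonne_elim_neq0 n (M : 'M[F]_n) (b : 'I_n -> F) :
  dieudonne_elim M != 0 -> exists c, forall l, row_combination M c l = b l.
Proof.
elim: n M b => [|n IH] M b; first by exists (fun=> 0) => -[].
rewrite dieudonne_elimS; case: pickP => [i Mi0|_]; last by rewrite eqxx.
move=> E; have {}E : dieudonne_elim (pivot_step M i) != 0.
  by apply: contra_neq E => ->; rewrite mulr0.
(* Back substitution: the target is reduced by the same multiple of the pivot row that [pivot_lift]
   adds back. *)
have [c cE] := IH _ (fun l => b (lift 0 l) - M i (lift 0 l) * ((M i 0)^-1 * b 0)) E.
have [c' [_ c'0 c'S]] := pivot_lift c (b 0) Mi0.
by exists c' => l; case: (unliftP 0 l) => [l'|] ->; rewrite // c'S cE subrK.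
Qed.

End DivisionRing.

(** * Leading coefficients in the skew polynomial ring *)

Section SkewCoef.
Variables (F : nzRingType) (sigma : {rmorphism F -> F}).
Variables (delta : {additive F -> F}) (deltaM : sigma_derivation sigma delta).
Implicit Types f g : skewpoly deltaM.

Local Notation x := (skewX deltaM).
Local Notation C := (skewC deltaM).
Local Notation poly_of f := ((f%R : skewpoly deltaM) : {poly F}).

Lemma coef_skew_mulX (p : {poly F}) i : (skew_mulX sigma delta p)`_i =
  (if i is i'.+1 then sigma p`_i' else 0) + delta p`_i.
Proof.
by rewrite coefD coefMX !coef_map_id0 ?raddf0 //; case: i => //= i; rewrite coef_map_id0 ?raddf0.
Qed.

Lemma skew_mulX_top n (p : {poly F}) : (size p <= n.+1)%N ->
  (size (skew_mulX sigma delta p) <= n.+2)%N /\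
  (skew_mulX sigma delta p)`_n.+1 = sigma p`_n.
Proof.
move=> /leq_sizeP p0; split; last by rewrite coef_skew_mulX (p0 n.+1) // raddf0 addr0.
apply/leq_sizeP => -[|j] // lt_nj; rewrite coef_skew_mulX !p0 ?raddf0 ?addr0 //.
exact: leqW.
Qed.

Lemma iter_skew_mulX_top k n (p : {poly F}) : (size p <= n.+1)%N ->
  (size (iter k (skew_mulX sigma delta) p) <= (k + n).+1)%N /\
  (iter k (skew_mulX sigma delta) p)`_(k + n) = iter k sigma p`_n.
Proof.
move=> sp; elim: k => //= k [sk ck].
by have [s' c'] := skew_mulX_top sk; rewrite addSn c' ck.
Qed.

(** Moving $x^m$ past a coefficient $b$ gives $\sigma^m(b)x^m$ plus lower terms. Sizes are only
    bounded, so the top coefficients may vanish. *)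
Lemma skew_mul_top m n f g :
  (size (poly_of f) <= m.+1)%N -> (size (poly_of g) <= n.+1)%N ->
  (size (poly_of (f * g)) <= (m + n).+1)%N /\
  (poly_of (f * g))`_(m + n) = (poly_of f)`_m * iter m sigma (poly_of g)`_n.
Proof.
move=> sf sg.
have -> : poly_of (f * g) = \sum_(i < m.+1)
    (poly_of f)`_i *: iter i (skew_mulX sigma delta) g.
  rewrite -[LHS]/(skew_mul sigma delta f g) /skew_mul.
  rewrite (big_ord_widen m.+1
    (fun i => (poly_of f)`_i *: iter i (skew_mulX sigma delta) g)) //.
  rewrite [RHS](bigID (fun i : 'I_m.+1 => (i < size (poly_of f))%N)) /=.
  rewrite [X in _ = _ + X]big1 ?addr0 // => i.
  by rewrite -leqNgt => /leq_sizeP/(_ _ (leqnn _))->; rewrite scale0r.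
have top i := iter_skew_mulX_top i sg.
split.
  apply: (leq_trans (size_sum _ _ _)); apply/bigmax_leqP => i _.
  apply: (leq_trans (size_scale_leq _ _)); apply: (leq_trans (top i).1).
  by rewrite ltnS leq_add2r -ltnS.
rewrite big_ord_recr /= coefD coefZ (top m).2 coef_sum big1 ?add0r // => i _.
rewrite coefZ [X in _ * X]nth_default ?mulr0 //.
by apply: (leq_trans (top i).1); rewrite ltn_add2r.
Qed.

(** The coefficients form a function on [nat], not a list, so that a Sylvester row
    [sylvester_entry sigmaV delta A j] can be plugged in directly. *)
Definition right_poly n (c : nat -> F) : skewpoly deltaM := \sum_(i < n) x ^+ i * C (c i).

Lemma right_monomial_top i a :
  (size (poly_of (x ^+ i * C a)) <= i.+1)%N /\
  (poly_of (x ^+ i * C a))`_i = iter i sigma a.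
Proof.
have sX : (size (poly_of (x ^+ i)) <= i.+1)%N by rewrite skewXnE size_polyXn.
have := skew_mul_top sX (size_polyC_leq1 a).
by rewrite addn0 skewXnE coefXn eqxx mul1r coefC eqxx.
Qed.

Lemma size_right_poly n c : (size (poly_of (right_poly n c)) <= n)%N.
Proof.
elim: n => [|n IH]; first by rewrite /right_poly big_ord0 size_poly0.
rewrite /right_poly big_ord_recr /=; apply: (leq_trans (size_polyD _ _)).
by rewrite geq_max (leqW IH) (right_monomial_top n (c n)).1.
Qed.

(** Uniqueness of right-hand coefficients: the top left-hand coefficient is $\sigma^n(c_n)$, so
    injectivity of [sigma] kills the last [c n], and induction kills the rest. *)
Lemma right_poly_eq0 n c : injective sigma -> right_poly n c = 0 ->
  forall i, (i < n)%N -> c i = 0.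
Proof.
move=> sI; elim: n => // n IH E.
have cn : c n = 0.
  have : (poly_of (right_poly n.+1 c))`_n = 0 by rewrite E coef0.
  rewrite /right_poly big_ord_recr /= coefD (right_monomial_top n (c n)).2.
  rewrite nth_default ?size_right_poly // add0r.
  by elim: (n in iter n) => //= k IHk /eqP; rewrite raddf_eq0 // => /eqP.
have {}E : right_poly n c = 0.
  by rewrite -E /right_poly [RHS]big_ord_recr /= cn [C 0]polyC0 mulr0 addr0.
move=> i; rewrite ltnS leq_eqVlt => /predU1P[->//|]; exact: IH.
Qed.

End SkewCoef.

(** * Right-hand coefficients and the rows of the Sylvester matrix *)

Section RightCoef.
Variables (F : unitRingType) (sigma : {rmorphism F -> F}) (sigmaV : F -> F).
Hypotheses (sigmaK : cancel sigma sigmaV) (sigmaVK : cancel sigmaV sigma).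
Variables (delta : {additive F -> F}) (deltaM : sigma_derivation sigma delta).
Implicit Types f g : skewpoly deltaM.

Local Notation x := (skewX deltaM).
Local Notation C := (skewC deltaM).
Local Notation poly_of f := ((f%R : skewpoly deltaM) : {poly F}).
Local Notation "c ^x" := (fun t : nat =>
  (if t is t'.+1 then sigmaV (c t') else 0) - delta (sigmaV (c t))) (at level 2).

Let sigmaVB : zmod_morphism sigmaV.
Proof. by move=> a b; rewrite -{1}[a]sigmaVK -{1}[b]sigmaVK -rmorphB sigmaK. Qed.
HB.instance Definition _ := GRing.isZmodMorphism.Build F F sigmaV sigmaVB.

Lemma right_poly_widen m n (c : nat -> F) : (m <= n)%N ->
  (forall t, (m <= t)%N -> c t = 0) -> right_poly deltaM n c = right_poly deltaM m c.
Proof.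
move=> le_mn c0; rewrite /right_poly -!(big_mkord xpredT (fun i => x ^+ i * C (c i))).
rewrite (big_cat_nat _ le_mn) //= [X in _ + X]big_nat [X in _ + X]big1 ?addr0 // => i.
by move=> /andP[le_mi _]; rewrite c0 // [C 0]polyC0 mulr0.
Qed.

(** Rests on $ax = x\sigma^{-1}(a) - \delta(\sigma^{-1}(a))$. The hypothesis [c n = 0] removes the
    term that [c^x] would otherwise subtract in degree [n] without counterpart. *)
Lemma right_polyX n (c : nat -> F) : c n = 0 ->
  right_poly deltaM n c * x = right_poly deltaM n.+1 c^x.
Proof.
move=> cn; have CB a b : C (a - b) = C a - C b by exact: polyCB.
have C0 : C 0 = 0 by exact: polyC0.
rewrite [RHS]/right_poly; under [RHS]eq_bigr do rewrite CB mulrBr.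
rewrite sumrB big_ord_recl C0 mulr0 add0r [X in _ - X]big_ord_recr /= cn.
rewrite !raddf0 C0 mulr0 addr0 -sumrB mulr_suml; apply: eq_bigr => t _.
by rewrite exprSr -!mulrA -mulrBr skewXC sigmaVK addrK.
Qed.

(** [skewT] reindexed by the word length [n], which keeps sums such as [j - i + i] out of the tuple
    type. *)
Definition skewW n t (a : F) : F :=
  \sum_(w : n.-tuple bool | count_mem true w == t)
    foldr (fun (b : bool) y => if b then delta (sigmaV y) else sigmaV y) a w.

Lemma skewW_S n t a : skewW n.+1 t a =
  (if t is t'.+1 then delta (sigmaV (skewW n t' a)) else 0) + sigmaV (skewW n t a).
Proof.
rewrite /skewW (@sum_tuple_bool_cons F n (fun w => count_mem true w == t)
  (foldr (fun (b : bool) y => if b then delta (sigmaV y) else sigmaV y) a)) /=.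
congr (_ + _); last by rewrite raddf_sum.
by case: t => [|t]; [rewrite big1 | rewrite !raddf_sum].
Qed.

Lemma skewW_gt n t a : (n < t)%N -> skewW n t a = 0.
Proof.
move=> lt_nt; apply: big1 => w /eqP E; have := count_size (pred1 true) w.
by rewrite size_tuple E leqNgt lt_nt.
Qed.

Lemma skewW_0 n t : skewW n t 0 = 0.
Proof.
apply: big1 => w _; elim: (w : seq bool) => //= -[] s ->; by rewrite !raddf0.
Qed.

Lemma sylvester_entryE (A : {poly F}) j t : sylvester_entry sigmaV delta A j t =
  \sum_(i < j.+1) (-1) ^+ (j + i) * skewW j (j - i)%N (if (i <= t)%N then A`_(t - i) else 0).
Proof.
apply: eq_bigr => i _; congr (_ * _); rewrite -[skewT _ _ _ _ _]/(skewW (j - i + i) _ _).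
by rewrite subnK // -ltnS.
Qed.

Lemma sylvester_entry0 (A : {poly F}) t : sylvester_entry sigmaV delta A 0 t = A`_t.
Proof.
rewrite sylvester_entryE big_ord1 mul1r /= subn0 /skewW (big_pred1 [tuple]) ?subn0 // => w.
by rewrite (tuple0 w); apply/esym/eqP.
Qed.

(** Among the words of length [j.+1], those with outermost letter $\sigma^{-1}$ give the shifted
    term and those with outermost letter $\delta\sigma^{-1}$ the subtracted one. *)
Lemma sylvester_entryS (A : {poly F}) j t : sylvester_entry sigmaV delta A j.+1 t =
  (sylvester_entry sigmaV delta A j)^x t.
Proof.
have sgnV n a : sigmaV ((-1) ^+ n * a) = (-1) ^+ n * sigmaV a.
  by rewrite -signr_odd !mulr_sign; case: odd; rewrite ?raddfN.
have sgnD n a : delta ((-1) ^+ n * a) = (-1) ^+ n * delta a.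
  by rewrite -signr_odd !mulr_sign; case: odd; rewrite ?raddfN.
rewrite sylvester_entryE; under eq_bigr do rewrite skewW_S mulrDr.
rewrite big_split /= addrC; congr (_ + _).
  (* For [i = 0] a word of length [j] would need [j.+1] letters $\delta\sigma^{-1}$. *)
  rewrite big_ord_recl skewW_gt ?subn0 // raddf0 mulr0 add0r.
  case: t => [|t]; last rewrite sylvester_entryE raddf_sum.
    by apply: big1 => i _; rewrite skewW_0 raddf0 mulr0.
  apply: eq_bigr => i _.
  by rewrite /= sgnV /bump /= add1n addnS addSn !exprS mulrA mulrNN !mul1r subSS ltnS subSS.
(* For [i = j.+1] there is no letter $\delta\sigma^{-1}$ that could be outermost. *)
rewrite big_ord_recr /= subnn mulr0 addr0 sylvester_entryE !raddf_sum /=.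
apply: eq_bigr => i _.
have le_ij : (i <= j)%N by rewrite -ltnS.
by rewrite /= sgnV sgnD (subSn le_ij) addSn exprS mulN1r mulNr.
Qed.

Lemma sylvester_entry_gt (A : {poly F}) j t : (size A + j <= t)%N ->
  sylvester_entry sigmaV delta A j t = 0.
Proof.
elim: j t => [|j IH] t; first by rewrite addn0 sylvester_entry0 => /leq_sizeP->.
rewrite addnS sylvester_entryS; case: t => // t; rewrite ltnS /= => le_t.
by rewrite (IH t) ?(IH t.+1) ?leqW // !raddf0 addr0.
Qed.

Lemma size_rcoefs f : (size (rcoefs sigmaV f) <= size (poly_of f))%N.
Proof.
have sX p : (size (rcoef_mulX sigmaV delta p) <= (size p).+1)%N.
  rewrite /rcoef_mulX; apply: (leq_trans (size_polyD _ _)).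
  rewrite size_polyN geq_max (leq_trans (size_poly _ _)) // andbT.
  rewrite (leq_trans (size_polyMleq _ _)) // size_polyX addn2 /= ltnS.
  exact: size_poly.
apply: (leq_trans (size_sum _ _ _)); apply/bigmax_leqP => j _.
apply: leq_trans (ltn_ord j); elim: (j : nat) (_`_j) => [|k IH] a.
  exact: size_polyC_leq1.
by apply: (leq_trans (sX _)); apply: IH.
Qed.

(** Iterating [sylvester_entryS] along [right_polyX] turns the closed formula into the coefficients
    of the product. The bound [n] is free because all Sylvester rows share one length. *)
Lemma mul_skewXn_right n j f : (size (poly_of f) + j <= n)%N ->
  f * x ^+ j = right_poly deltaM n (sylvester_entry sigmaV delta (rcoefs sigmaV f) j).
Proof.
move=> le_n; set A := rcoefs sigmaV f.
have -> : right_poly deltaM n (sylvester_entry sigmaV delta A j) =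
    right_poly deltaM (size A + j) (sylvester_entry sigmaV delta A j).
  apply: right_poly_widen => [|t]; last exact: sylvester_entry_gt.
  by apply: leq_trans le_n; rewrite leq_add2r size_rcoefs.
elim: j {le_n} => [|j IH].
  rewrite expr0 mulr1 addn0 [LHS](rcoefsE sigmaVK); apply: eq_bigr => i _.
  by rewrite sylvester_entry0.
rewrite exprSr mulrA IH right_polyX; last exact: sylvester_entry_gt.
by rewrite addnS; apply: eq_bigr => i _; rewrite sylvester_entryS.
Qed.

(** Right multiplication by a constant acts entrywise on right-hand coefficients, so the product
    becomes a right combination of rows. The second factor has only powers of $x$ below [k], hence
    the bound [n.+1]. *)
Lemma mul_right_poly n k f (c : nat -> F) : (size (poly_of f) + k <= n.+1)%N ->
  f * right_poly deltaM k c = right_poly deltaM n (fun t =>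
    \sum_(j < k) sylvester_entry sigmaV delta (rcoefs sigmaV f) j t * c j).
Proof.
move=> le_n; have CS := raddf_sum (polyC : {additive F -> {poly F}}).
rewrite [in LHS]/right_poly mulr_sumr [RHS]/right_poly.
under [RHS]eq_bigr => t _ do rewrite [C _]CS mulr_sumr.
rewrite [RHS]exchange_big /=; apply: eq_bigr => j _.
rewrite mulrA (@mul_skewXn_right n); last first.
  by rewrite -ltnS (leq_trans _ le_n) // -addnS leq_add2l.
rewrite mulr_suml; apply: eq_bigr => t _; rewrite -mulrA; congr (_ * _).
by rewrite skewCM /skewC -mul_polyC polyCM.
Qed.

End RightCoef.

(** * Left division, common left factors and greatest common left divisors *)

Section SkewDivision.
Variables (F : unitRingType) (F_division : GRing.field_axiom F).
Variables (sigma : {rmorphism F -> F}) (sigmaV : F -> F).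
Hypotheses (sigmaK : cancel sigma sigmaV) (sigmaVK : cancel sigmaV sigma).
Variables (delta : {additive F -> F}) (deltaM : sigma_derivation sigma delta).
Implicit Types f g p q : skewpoly deltaM.

Local Notation x := (skewX deltaM).
Local Notation C := (skewC deltaM).
Local Notation poly_of f := ((f%R : skewpoly deltaM) : {poly F}).

(** The leading coefficients combine to $a\sigma^m(b)$, nonzero because [sigma] is injective and [F]
    is a division ring. *)
Lemma size_skew_mul f g : f != 0 -> g != 0 ->
  size (poly_of (f * g)) = (size (poly_of f) + size (poly_of g)).-1.
Proof.
move=> f0 g0; have lead (h : skewpoly deltaM) : h != 0 ->
    exists2 n, size (poly_of h) = n.+1 & (poly_of h)`_n != 0.
  move=> h0; exists (size (poly_of h)).-1.
    by rewrite prednK // lt0n size_poly_eq0.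
  by rewrite -lead_coefE lead_coef_eq0.
have [m sf fm] := lead f f0; have [n sg gn] := lead g g0.
have [s c] := skew_mul_top (eq_leq sf) (eq_leq sg).
rewrite sf sg addSn /= addnS; apply/eqP; rewrite eqn_leq s /= ltnNge.
have : (poly_of (f * g))`_(m + n) != 0.
  rewrite c division_mulf_neq0 //; elim: (m in iter m) => //= k IH.
  by rewrite raddf_eq0 //; apply: can_inj sigmaK.
by apply: contra_neqN => le; rewrite nth_default.
Qed.

Lemma skew_mulf_neq0 f g : f != 0 -> g != 0 -> f * g != 0.
Proof.
move=> f0 g0; have := size_skew_mul f0 g0.
have : (0 < size (poly_of f))%N by rewrite lt0n size_poly_eq0.
have : (0 < size (poly_of g))%N by rewrite lt0n size_poly_eq0.
case: (size (poly_of f)) (size (poly_of g)) => [|m] [|n] // _ _.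
by rewrite addSn addnS /=; apply: contra_eq_neq => ->; rewrite [X in X != _]size_poly0.
Qed.

Lemma two_sided_unit_size f : two_sided_unit f -> size (poly_of f) = 1%N.
Proof.
move=> [v [fv _]]; have f0 : f != 0.
  by apply: contra_eq_neq fv => ->; rewrite mul0r eq_sym oner_eq0.
have v0 : v != 0.
  by apply: contra_eq_neq fv => ->; rewrite mulr0 eq_sym oner_eq0.
have := size_skew_mul f0 v0; rewrite fv [LHS]size_poly1.
have : (0 < size (poly_of f))%N by rewrite lt0n size_poly_eq0.
have : (0 < size (poly_of v))%N by rewrite lt0n size_poly_eq0.
by case: (size (poly_of f)) (size (poly_of v)) => [|[|m]] [|n] // _ _; rewrite addSn addnS.
Qed.

(** A right inverse [v] is also a left inverse: $f(vf-1)=0$, and there are no zero divisors. *)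
Lemma left_divides1_unit f : left_divides f 1 -> two_sided_unit f.
Proof.
move=> [v fv]; exists v; split => //; apply/eqP; rewrite -subr_eq0.
have f0 : f != 0.
  by apply/eqP => E; move/eqP: fv; rewrite E mul0r oner_eq0.
apply: contraT => /(skew_mulf_neq0 f0); rewrite mulrBr mulrA -fv mul1r mulr1.
by rewrite subrr eqxx.
Qed.

Lemma skew_left_division f g : g != 0 ->
  exists s r, f = g * s + r /\ (size (poly_of r) < size (poly_of g))%N.
Proof.
move=> g0; move: {2}(size (poly_of f)) (leqnn (size (poly_of f))) => N.
elim: N f => [|N IH] f le_fN.
  exists 0, f; rewrite mulr0 add0r; split=> //.
  by apply: (leq_ltn_trans le_fN); rewrite lt0n size_poly_eq0.
have [lt_fg|le_gf] := ltnP (size (poly_of f)) (size (poly_of g)).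
  by exists 0, f; rewrite mulr0 add0r.
have [n sg] : exists n, size (poly_of g) = n.+1.
  by exists (size (poly_of g)).-1; rewrite prednK // lt0n size_poly_eq0.
have gn : (poly_of g)`_n != 0.
  by have := lead_coef_eq0 (poly_of g); rewrite lead_coefE sg /= => ->.
have [d sf] : exists d, size (poly_of f) = (n + d).+1.
  by exists (size (poly_of f) - n.+1)%N; rewrite -addSn subnKC // -sg.
(* Chosen so that $g_n\sigma^n(b)=f_{n+d}$, which makes $g\,b x^d$ match the leading term of [f];
   this uses that [sigma] is onto. *)
pose b := iter n sigmaV (((poly_of g)`_n)^-1 * (poly_of f)`_(n + d)).
have sh : (size (poly_of (C b * x ^+ d)) <= d.+1)%N.
  by rewrite skewCM skewXnE (leq_trans (size_scale_leq _ _)) // size_polyXn.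
have [s c] := skew_mul_top (eq_leq sg) sh.
have bK : iter n sigma b = ((poly_of g)`_n)^-1 * (poly_of f)`_(n + d).
  rewrite /b; move: n {sg gn sf b sh s c} (_ * _) => k.
  by elim: k => // k IHk a; rewrite iterSr iterS sigmaVK.
have [s' [r [E lt_r]]] : exists s r,
    f - g * (C b * x ^+ d) = g * s + r /\ (size (poly_of r) < size (poly_of g))%N.
  apply: IH; rewrite -ltnS; apply: leq_trans le_fN; rewrite sf ltnS.
  apply/leq_sizeP => j; rewrite leq_eqVlt => lt_j; rewrite [LHS]coefB.
  case/predU1P: lt_j => [<-|lt_j].
    rewrite c skewCM skewXnE coefZ coefXn eqxx mulr1 bK.
    by rewrite mulrA division_mulrV // mul1r subrr.
  by rewrite !nth_default ?subr0 // ?sf // (leq_trans s).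
exists (C b * x ^+ d + s'), r; split=> //.
by rewrite mulrDr -addrA -E addrC subrK.
Qed.

(* Euclid's algorithm: if f = g s + r then g (s p + q) = - r p, a relation of
   the same kind between g and r. *)
Lemma common_left_factor f g p q : g != 0 -> p != 0 ->
  (size (poly_of p) < size (poly_of g))%N -> f * p + g * q = 0 ->
  exists h, [/\ ~ two_sided_unit h, left_divides h f & left_divides h g].
Proof.
move: {2}(size (poly_of g)) (leqnn (size (poly_of g))) => N.
elim: N f g p q => [|N IH] f g p q le_gN g0 p0 lt_pg E.
  by move: g0; rewrite -size_poly_eq0 -leqn0 le_gN.
have [s [r [fE lt_rg]]] := skew_left_division f g0.
have [r0|r0] := eqVneq r 0.
  (* Here [g] left divides [f], and it is no unit because [p] is nonzero and smaller than [g]. *)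
  exists g; split; last by exists 1; rewrite mulr1.
    move=> /two_sided_unit_size sg; move: lt_pg.
    by rewrite sg ltnS leqn0 size_poly_eq0 (negPf p0).
  by exists s; rewrite fE r0 addr0.
have {}E : g * (s * p + q) = - (r * p).
  by apply/eqP; rewrite -addr_eq0 -E fE mulrDr mulrDl !mulrA addrAC.
have q0 : s * p + q != 0.
  apply: contraTneq (skew_mulf_neq0 r0 p0) => q0.
  by rewrite -oppr_eq0 -E q0 mulr0 eqxx.
have [|||h [hU hg hr]] := IH g r (s * p + q) p _ r0 q0.
- by rewrite -ltnS (leq_trans lt_rg).
(* Degrees in $g(sp+q)=-rp$: since [p] is smaller than [g], the factor [s * p + q] is smaller than
   [r]. *)
- have := size_skew_mul g0 q0; rewrite E [LHS]size_polyN size_skew_mul //.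
  move: lt_pg lt_rg; case: (size (poly_of g)) => // m.
  have : (0 < size (poly_of r))%N by rewrite lt0n size_poly_eq0.
  case: (size (poly_of r)) => // k _; rewrite !addSn /= ltnS => le_p _ E'.
  by rewrite ltnS -(leq_add2l m) -E' addnC leq_add2r.
- by rewrite E addNr.
exists h; split => //; case: hg hr => [u ->] [v ->] in fE *.
by exists (u * s + v); rewrite fE mulrDr mulrA.
Qed.

(** [xget] returns a member of the set as soon as one exists. *)
Lemma gcld_spec f g d : is_gcld f g d -> is_gcld f g (gcld f g).
Proof. by rewrite /gcld; case: xgetP => [e -> //|/(_ d)]. Qed.

(** The default value 0 differs from 1, so the value 1 must come from a genuine gcld. *)
Lemma gcld_eq1 f g : gcld f g = 1 -> is_gcld f g 1.
Proof.
rewrite /gcld; case: xgetP => [d _ gd <- //|_ /eqP].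
by rewrite eq_sym oner_eq0.
Qed.

(** Translates between combinations of Sylvester rows and expressions $fp+gq$: the first
    [skew_deg g] entries of [c] are the coefficients of $p$, the following ones those of $q$. *)
Lemma left_sylvester_combination f g (c : nat -> F) :
  f * right_poly deltaM (skew_deg g) c +
  g * right_poly deltaM (skew_deg f) (fun k => c (skew_deg g + k)%N) =
  right_poly deltaM (skew_deg f + skew_deg g) (fun t =>
    \sum_(k < skew_deg f + skew_deg g)
      (if (k < skew_deg g)%N then sylvester_entry sigmaV delta (rcoefs sigmaV f) k t
       else sylvester_entry sigmaV delta (rcoefs sigmaV g) (k - skew_deg g) t) * c k).
Proof.
rewrite !(@mul_right_poly F sigma sigmaV sigmaK sigmaVK delta deltaM
  (skew_deg f + skew_deg g)) ?addSn; first last.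
- by rewrite -addSn leq_add2r leqSpred.
- by rewrite addnC -addnS leq_add2l leqSpred.
rewrite /right_poly -big_split; apply: eq_bigr => t _ /=.
rewrite -mulrDr -[in LHS]polyCD; congr (_ * C _).
move: (t : nat) => {}t; rewrite (addnC (skew_deg f)) big_split_ord /=; congr (_ + _).
  by apply: eq_bigr => k _; rewrite ltn_ord.
by apply: eq_bigr => k _; rewrite ltnNge leq_addr addKn.
Qed.

End SkewDivision.

(** * The cycle of implications between the five conditions *)

Theorem theorem3p30 (F : unitRingType) (F_division : GRing.field_axiom F)
  (sigma : {rmorphism F -> F}) (sigmaV : F -> F)
  (sigmaK : cancel sigma sigmaV) (sigmaVK : cancel sigmaV sigma)
  (delta : {additive F -> F}) (deltaM : sigma_derivation sigma delta)
  (f g : skewpoly deltaM) (f_deg : (0 < skew_deg f)%N)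
  (g_deg : (0 < skew_deg g)%N) :
  [<-> left_resultant sigmaV f g = dieudonne_class 0;
       exists h : skewpoly deltaM,
         [/\ ~ two_sided_unit h, left_divides h f & left_divides h g];
       gcld f g <> 1;
       ~ (exists p q : skewpoly deltaM, f * p + g * q = 1);
       (sum_right_ideals f g `<` [set: skewpoly deltaM])%classic ].
Proof.
have neq0 (h : skewpoly deltaM) : (0 < skew_deg h)%N -> h != 0.
  by apply: contraTneq => ->; rewrite /skew_deg [size _]size_poly0.
have [f0 g0] := (neq0 f f_deg, neq0 g g_deg).
set m := skew_deg f; set n := skew_deg g.
(* [right_poly] takes coefficients indexed by [nat], so vectors are padded with 0. *)
pose ext (c : 'I_(m + n) -> F) k := if insub k is Some i then c i else 0.
have extE c (i : 'I_(m + n)) : ext c i = c i by rewrite /ext valK.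
have combE c : f * right_poly deltaM n (ext c) +
    g * right_poly deltaM m (fun k => ext c (n + k)%N) =
    \sum_(t < m + n) skewX deltaM ^+ t *
      skewC deltaM (row_combination (left_sylvester sigmaV f g) c t).
  rewrite (left_sylvester_combination sigmaK sigmaVK); apply: eq_bigr => t _.
  by congr (_ * skewC _ _); apply: eq_bigr => k _; rewrite mxE extE.
have sigmaI := can_inj sigmaK.
tfae.
- move=> /dieudonne_class_eq0/(dieudonne_elim_eq0 F_division)[c [k ck] cN].
  have E : f * right_poly deltaM n (ext c) +
      g * right_poly deltaM m (fun k => ext c (n + k)%N) = 0.
    by rewrite combE big1 // => t _; rewrite cN [skewC _ 0]polyC0 mulr0.
  apply: (common_left_factor F_division sigmaK sigmaVK g0 _ _ E); last first.
    by rewrite (leq_ltn_trans (size_right_poly _ _ _)) // ltn_predL lt0n size_poly_eq0.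
  (* If $p=0$ then $gq=0$, so $q=0$, and uniqueness of right-hand coefficients makes all of [c]
     vanish. *)
  apply: contraNneq ck => p0; have := E; rewrite p0 mulr0 add0r => {}E.
  have {}E : right_poly deltaM m (fun k => ext c (n + k)%N) = 0.
    by apply/eqP; apply: contra_eqT E => /(skew_mulf_neq0 F_division sigmaK g0).
  rewrite -extE; have [lt_kn|le_nk] := ltnP k n.
    by rewrite (right_poly_eq0 sigmaI p0).
  by rewrite -(subnKC le_nk) (right_poly_eq0 sigmaI E) // ltn_subLR // [X in (_ < X)%N]addnC.
(* [h] would left divide the gcld 1 and hence be a unit. *)
- move=> [h [hU hf hg]] E1; apply: hU; apply: left_divides1_unit => //.
  by have [_ _ _] := gcld_eq1 E1; apply.
- move=> gN [p [q E]]; apply: gN.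
  (* By the Bezout relation every common left divisor left divides 1. *)
  have g1 : is_gcld f g 1.
    split; [exact: lead_coef1| by exists f; rewrite mul1r|by exists g; rewrite mul1r|].
    by move=> e [u fE] [v gE]; exists (u * p + v * q); rewrite -E fE gE mulrDr !mulrA.
  (* The chosen [gcld f g] left divides 1, so it is a constant, and being monic it equals 1. *)
  have [] := gcld_spec g1; set d := gcld f g => dm df dg _.
  have [_ _ _ /(_ d df dg)/(left_divides1_unit F_division sigmaK)] := g1.
  move=> /(two_sided_unit_size F_division sigmaK)/eqP/size_poly1P[a a0 dE].
  by move: dm; rewrite /skew_monic dE lead_coefC => ->.
- move=> N; split=> // /(_ 1 I) [p [q E]]; apply: N.
  by exists p, q.
- move=> [_ N]; apply/dieudonne_class_eq0/eqP; apply: contraPT N => /= detN0.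
  suff [p [q E]] : exists p q : skewpoly deltaM, f * p + g * q = 1.
    by apply => h _; exists (p * h), (q * h); rewrite !mulrA -mulrDl E mul1r.
  have mn : (0 < m + n)%N by rewrite addn_gt0 f_deg.
  (* The target vector holds the right-hand coefficients of the polynomial 1. *)
  have [c cE] := dieudonne_elim_neq0 F_division (fun t => (t == Ordinal mn)%:R) detN0.
  exists (right_poly deltaM n (ext c)), (right_poly deltaM m (fun k => ext c (n + k)%N)).
  rewrite combE (bigD1 (Ordinal mn)) //= cE eqxx.
  rewrite big1 ?addr0 ?mul1r // => t /negPf t0.
  by rewrite cE t0 [skewC _ 0]polyC0 mulr0.
Qed.
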